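(* Assume: (1) $G_0$ is analytic, and the frequencies $\omega_1,\dots,\omega_K$ are distinct, of the form $\omega_i=\log(p_i/q_i)>0$ with $\{p_i,q_i\}$ distinct positive integers; (2) $a_t=(1+t)^{-\rho}$ with $\tfrac12<\rho<1$, and $\beta>0$ is constant; (3) $f$ and $\bar f$ are Lipschitz: for some $L_f<\infty$ and all $x,x'\in\mathbb R^{2d}$, $\xi,\xi'\in\mathbb R^m$, $\|f(x',\xi)-f(x,\xi)\|\le L_f\|x'-x\|$, $\|f(x,\xi')-f(x,\xi)\|\le L_f\|\xi'-\xi\|$, $\|\bar f(x')-\bar f(x)\|\le L_f\|x'-x\|$. Then the fast variable satisfies $$\tfrac{d}{dt}\Lambda_t=\beta\bigl[\bar h(\Theta_t,\Lambda_t)-\beta\bar\Upsilon^{\sf ff}(\Theta_t,\Lambda_t)+\mathcal W_t\bigr],\qquad \mathcal W_t=\sum_{i=0}^2\beta^{2-i}\frac{d^i}{dt^i}\mathcal W^i_t,$$ with $\bar\Upsilon^{\sf ff}\equiv 0$, $\mathcal W^2_t=\hat{\hat h}_t$, $$\mathcal W^0_t=-[\mathcal D^h\widehat\Upsilon^{\sf ff}]_t+\frac{a_t}{\beta^2}\Bigl[r_t[\mathcal D^g\hat{\hat h}]_t-\Upsilon^{\sf sf}_t-\beta[\mathcal D^g\widehat\Upsilon^{\sf ff}]_t\Bigr],$$ $$\mathcal W^1_t=-[\mathcal D^h\hat{\hat h}]_t+\widehat\Upsilon^{\sf ff}_t-\frac{a_t}{\beta}[\mathcal D^g\hat{\hat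 h}]_t,$$ where $r_t=\rho/(1+t)$.
   Context: Let $d,m,K\ge1$ be integers and $j=\sqrt{-1}$. Points of $\mathbb R^{2d}$ are written $x=(\theta;\lambda)$, $\theta,\lambda\in\mathbb R^d$. Probing signal: $\xi_t=G_0(\xi^0_t)\in\mathbb R^m$, with $G_0:\mathbb R^K\to\mathbb R^m$ continuous and $\xi^0_t=[\cos(2\pi[\omega_1t+\phi_1]);\dots;\cos(2\pi[\omega_Kt+\phi_K])]$. The clock process $\Phi_t$ has entries $\Phi^i_t=\exp(2\pi j[\omega_it+\phi_i])$, evolves in a compact set $\Omega\subset\mathbb C^K$, and solves $\frac{d}{dt}\Phi_t=W\Phi_t$, $W=2\pi j\,\mathrm{diag}(\omega_i)$; thus $\xi_t=G(\Phi_t)$ with $G(z)=G_0(\mathrm{Re}\,z)$. $\pi$ denotes the unique invariant probability measure of $\Phi$ (the uniform distribution on $\Omega$). Two-timescale QSA ODE: for $g,h:\mathbb R^{2d}\times\mathbb R^m\to\mathbb R^d$, $\frac{d}{dt}\Theta_t=a_tg(\Theta_t,\Lambda_t,\xi_t)$, $\frac{d}{dt}\Lambda_t=\beta h(\Theta_t,\Lambda_t,\xi_t)$. Write $X_t=(\Theta_t;\Lambda_t)$, $f=(g;h)$, and $\bar g,\bar h,\bar f$ for the averages, e.g. $\bar f(x)=\lim_{T\to\infty}\frac1T\int_0^Tf(x,\xi_t)\,dt$. Poisson's equation: for continuous vector-valued $u$ on $\mathbb R^{2d}\times\Omega$ let $\bar u(x)=\int_\Omega u(x,z)\,\pi(dz)$,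 $\tilde u=u-\bar u$. Then $\hat u$ denotes the solution of Poisson's equation with forcing function $u$: $\int_0^T\tilde u(x,\Phi_t)\,dt=\hat u(x,\Phi_0)-\hat u(x,\Phi_T)$ for all $T\ge0$ and $x$, normalized by $\int\hat u(x,z)\,\pi(dz)=0$. Here $\hat h$ has forcing function $h(x,G(z))$; $\hat{\hat h}$ has forcing function $\hat h$; $\widehat\Upsilon^{\sf ff}$ has forcing function $\Upsilon^{\sf ff}$ (below). Directional derivatives: $[\mathcal D^gu](x,z)=\partial_\theta u(x,z)\cdot g(x,G(z))$, $[\mathcal D^hu](x,z)=\partial_\lambda u(x,z)\cdot h(x,G(z))$. Set $\Upsilon^{\sf sf}=-[\mathcal D^g\hat h]$, $\Upsilon^{\sf ff}=-[\mathcal D^h\hat h]$, $\bar\Upsilon^{\sf ff}(x)=\int\Upsilon^{\sf ff}(x,z)\,\pi(dz)$. For a function $u$ on $\mathbb R^{2d}\times\Omega$, $u_t$ means $u(X_t,\Phi_t)$. It is part of the notation that the Poisson solutions and derivatives appearing in the statement exist (with the smoothness needed for them to be meaningful).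
   Formalization: The printed identity counts a_t r_t [D^g ĥ̂]_t twice and fails (e.g. g=1, h=sin θ sin ξ, G_0=id, K=1); it is proved, for t>0, with the gain a_t held fixed when d/dt is applied to W^1_t. *)

(* Defs.v *)
From HB Require Import structures.
From mathcomp Require Import all_boot all_order all_algebra.
From mathcomp Require Import all_classical all_reals all_analysis.
From mathcomp Require Import complex.

Set Implicit Arguments.
Unset Strict Implicit.
Unset Printing Implicit Defensive.

Import Order.TTheory GRing.Theory Num.Theory numFieldNormedType.Exports.

Local Open Scope classical_set_scope.
Local Open Scope ring_scope.

(* The type ascription is what gives R[i] the topology of its norm. *)
Definition Cx (R : realType) : numClosedFieldType := (R[i])%C.

Definition CK (R : realType) (K : nat) := 'rV[Cx R]_K.

Definition borelCK (R : realType) (K : nat) :=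
  g_sigma_algebraType (@open (CK R K)).

(* x = (theta; lambda), with x.1 = theta and x.2 = lambda. *)
Definition state (R : realType) (d : nat) := ('rV[R]_d * 'rV[R]_d)%type.

(* Vectors are rows, and the norms on 'rV[R]_n and on products are sup norms. *)

Section analytic.
Context (R : realType) (K m : nat).

(* A multi-index of degree n has all its entries at most n. *)
Definition homog_part (c : ('I_K -> nat) -> 'rV[R]_m) (y : 'rV[R]_K) (n : nat)
    : 'rV[R]_m :=
  \sum_(al : {ffun 'I_K -> 'I_n.+1} | (\sum_(i < K) al i)%N == n)
     (\prod_(i < K) y 0 i ^+ al i) *: c (fun i => al i : nat).

Definition homog_part_abs (c : ('I_K -> nat) -> 'rV[R]_m) (y : 'rV[R]_K)
    (n : nat) : R :=
  \sum_(al : {ffun 'I_K -> 'I_n.+1} | (\sum_(i < K) al i)%N == n)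
     (\prod_(i < K) `|y 0 i| ^+ al i) * `|c (fun i => al i : nat)|.

(* Around each point G is the sum of an absolutely convergent power series. *)
Definition real_analytic (G : 'rV[R]_K -> 'rV[R]_m) : Prop :=
  forall x0 : 'rV[R]_K, exists r : R, exists c : ('I_K -> nat) -> 'rV[R]_m,
    0 < r /\
    forall y : 'rV[R]_K, (forall i, `|y 0 i| < r) ->
      cvgn (series (homog_part_abs c y)) /\
      series (homog_part c y) @ \oo --> G (x0 + y).

End analytic.

Section clock.
Context (R : realType) (K : nat).
Implicit Types (w phi : 'I_K -> R) (z : CK R K).

Definition expj (y : R) : Cx R := (cos y +i* sin y)%C.

Definition torus : set (CK R K) := [set z | forall i, `|z 0 i| = 1].

Definition clock w phi (t : R) : CK R K :=
  \row_i expj (2 * pi * (w i * t + phi i)).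

(* exp(tW) z: the solution at time t of dPhi/dt = W Phi started from z. *)
Definition clock_flow w (t : R) z : CK R K :=
  \row_i (expj (2 * pi * (w i * t)) * z 0 i).

Definition xi0 w phi (t : R) : 'rV[R]_K :=
  \row_i cos (2 * pi * (w i * t + phi i)).

Definition Gz (m : nat) (G0 : 'rV[R]_K -> 'rV[R]_m) z : 'rV[R]_m :=
  G0 (\row_i complex.Re (z 0 i)).

(* The uniform distribution on the torus, that is its Haar probability: carried
   by the torus and invariant under all its rotations, hence under clock_flow.
   When the frequencies are linearly independent over the rationals, it is the
   only probability on the torus that is invariant under clock_flow. *)
Definition uniform_on_torus (P : probability (borelCK R K) R) : Prop :=
  P torus = 1%E /\
  forall v : CK R K, torus v -> forall A : set (borelCK R K), measurable A ->
    P [set z : CK R K | A (\row_i (v 0 i * z 0 i))] = P A.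

End clock.

Section averaging.
Context (R : realType) (d m K : nat).
Implicit Types (P : probability (borelCK R K) R) (w : 'I_K -> R).

Definition time_integral (n : nat) (u : R -> 'rV[R]_n) (T : R) : 'rV[R]_n :=
  \row_i \int[lebesgue_measure]_(t in `[0, T]) u t 0 i.

Definition time_average (u : state R d -> 'rV[R]_m -> 'rV[R]_d)
    (xi : R -> 'rV[R]_m) (x : state R d) : 'rV[R]_d :=
  lim ((fun T : R => T^-1 *: time_integral (fun t => u x (xi t)) T) @ +oo).

Definition mean P (u : state R d -> CK R K -> 'rV[R]_d) (x : state R d)
    : 'rV[R]_d :=
  \row_i \int[P]_(z in @torus R K) u x z 0 i.

(* uhat is the solution of Poisson's equation with forcing function u. As uhat
   is a function on all of R^(2d) x torus, the equation is required for every
   initial state z of the clock. *)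
Definition poisson_solution P w (u uhat : state R d -> CK R K -> 'rV[R]_d)
    : Prop :=
  forall x : state R d,
    (forall (z : CK R K) (T : R), torus z -> 0 <= T ->
       time_integral (fun t => u x (clock_flow w t z) - mean P u x) T
       = uhat x z - uhat x (clock_flow w T z)) /\
    mean P uhat x = 0.

(* Continuous on R^(2d) x torus, together with the derivative in x. *)
Definition C1_in_state (u : state R d -> CK R K -> 'rV[R]_d) : Prop :=
  [/\ {within [set: state R d] `*` @torus R K,
        continuous (fun p : state R d * CK R K => u p.1 p.2)},
      forall (x : state R d) (z : CK R K), torus z -> differentiable (u^~ z) x
    & forall v : state R d, {within [set: state R d] `*` @torus R K,
        continuous (fun p : state R d * CK R K => 'd (u^~ p.2) (p.1) v)}].

Definition D_theta (G : CK R K -> 'rV[R]_m)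
    (g : state R d -> 'rV[R]_m -> 'rV[R]_d)
    (u : state R d -> CK R K -> 'rV[R]_d) (x : state R d) (z : CK R K)
    : 'rV[R]_d :=
  'd (fun theta : 'rV[R]_d => u (theta, x.2) z) (x.1) (g x (G z)).

Definition D_lambda (G : CK R K -> 'rV[R]_m)
    (h : state R d -> 'rV[R]_m -> 'rV[R]_d)
    (u : state R d -> CK R K -> 'rV[R]_d) (x : state R d) (z : CK R K)
    : 'rV[R]_d :=
  'd (fun lambda : 'rV[R]_d => u (x.1, lambda) z) (x.2) (h x (G z)).

Definition Upsilon_sf (G : CK R K -> 'rV[R]_m)
    (g : state R d -> 'rV[R]_m -> 'rV[R]_d)
    (hhat : state R d -> CK R K -> 'rV[R]_d) x z : 'rV[R]_d :=
  - D_theta G g hhat x z.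

Definition Upsilon_ff (G : CK R K -> 'rV[R]_m)
    (h : state R d -> 'rV[R]_m -> 'rV[R]_d)
    (hhat : state R d -> CK R K -> 'rV[R]_d) x z : 'rV[R]_d :=
  - D_lambda G h hhat x z.

Definition along (X : R -> state R d) (Phi : R -> CK R K)
    (u : state R d -> CK R K -> 'rV[R]_d) (t : R) : 'rV[R]_d :=
  u (X t) (Phi t).

End averaging.

Section noise.
Context (R : realType) (d m K : nat).
Variables (rho beta : R) (G : CK R K -> 'rV[R]_m).
Variables (g h : state R d -> 'rV[R]_m -> 'rV[R]_d).
Variables (hhat hhathat Uffhat : state R d -> CK R K -> 'rV[R]_d).
Variables (X : R -> state R d) (Phi : R -> CK R K).

Definition gain (t : R) : R := (1 + t) `^ (- rho).

Definition rate (t : R) : R := rho / (1 + t).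

(* W^i_t, with the value alpha of the gain a_t as a separate argument. *)
Definition W_comp (i : nat) (alpha t : R) : 'rV[R]_d :=
  match i with
  | 0 => - along X Phi (D_lambda G h Uffhat) t
         + (alpha / beta ^+ 2) *:
           (rate t *: along X Phi (D_theta G g hhathat) t
            - along X Phi (Upsilon_sf G g hhat) t
            - beta *: along X Phi (D_theta G g Uffhat) t)
  | 1 => - along X Phi (D_lambda G h hhathat) t
         + along X Phi Uffhat t
         - (alpha / beta) *: along X Phi (D_theta G g hhathat) t
  | _ => along X Phi hhathat t
  end.

(* The time derivatives are taken with the gain factor a_t held fixed. The
   product rule gives
     - d/dt (a_t [D^g hhathat]_t)
       = a_t r_t [D^g hhathat]_t - a_t d/dt [D^g hhathat]_t,
   and the first term on the right is the r_t term of W^0_t. Differentiating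
   the factor a_t inside W^1_t as well would count that term twice. *)
Definition W_noise (t : R) : 'rV[R]_d :=
  \sum_(i < 3) beta ^+ (2 - i) *: derive1n i (W_comp i (gain t)) t.

End noise.

(* Main.v *)
(* If v solves Poisson's equation with forcing function u, then the chain rule
   along the trajectory reads
     d/dt v_t = a_t [D^g v]_t + beta [D^h v]_t - (u_t - ubar(X_t)).
   With (u, v) = (h, hhat), (hhat, hhathat) and (Upsilon^ff, Uffhat), and with
   the second identity differentiated once more, eliminating hhat_t and
   Upsilon^ff_t gives the formula for d/dt Lambda_t.
   The mean of Upsilon^ff vanishes by time reversal. As xi depends on the real
   part of the clock only, h is even under complex conjugation z -> z', which
   reverses the clock. Hence hhat is odd: hhat(x, z) + hhat(x, z') is constant
   along orbits, and it is the derivative of the bounded function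
   hhathat(x, z') - hhathat(x, z). So Upsilon^ff is odd, and twice its mean is
   the derivative of the bounded function Uffhat(x, z) - Uffhat(x, z'). *)

Require Import Defs.
From HB Require Import structures.
From mathcomp Require Import all_boot all_order all_algebra.
From mathcomp Require Import all_classical all_reals all_analysis.
From mathcomp Require Import complex ring lra.

Set Implicit Arguments.
Unset Strict Implicit.
Unset Printing Implicit Defensive.

Import Order.TTheory GRing.Theory Num.Theory numFieldNormedType.Exports.

Local Open Scope classical_set_scope.
Local Open Scope ring_scope.

(** * Derivatives of vector-valued curves, by difference quotients and coordinates *)

Section Derivatives.
Context {R : realType}.

Lemma is_derive1_cvgP (V : normedModType R) (f : R -> V) (t : R) (D : V) :
  is_derive t 1 f D <-> h^-1 *: (f (h + t) - f t) @[h --> 0^'] --> D.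
Proof.
have E : (fun h : R => h^-1 *: ((f \o shift t) (h *: 1) - f t)) =
         (fun h : R => h^-1 *: (f (h + t) - f t)).
  by apply/funext => h /=; rewrite [h *: 1]mulr1.
split=> [[fd <-]|fD].
  by rewrite /derivable /derive E in fd *.
by split; rewrite /derivable /derive E; [apply/cvg_ex; exists D|exact: cvg_lim].
Qed.

Lemma is_derive1_shift (V : normedModType R) (f : R -> V) (t a : R) (D : V) :
  is_derive (t + a) 1 f D -> is_derive t 1 (fun s => f (s + a)) D.
Proof.
rewrite !is_derive1_cvgP => fD.
by under eq_fun do rewrite -addrA.
Qed.

Lemma is_derive_rowP n (f : R -> 'rV[R]_n) (t : R) (D : 'rV[R]_n) :
  is_derive t 1 f D <-> forall i, is_derive t 1 (fun s => f s 0 i) (D 0 i).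
Proof.
split=> [[fd <-] i|fD].
  have fdi := (derivable_mxP _ _ _).1 fd 0 i.
  by apply: DeriveDef => //; rewrite derive_mx// mxE.
have fd : derivable f t 1.
  by apply/derivable_mxP => i j; rewrite ord1; apply: ex_derive.
apply: DeriveDef => //; apply/rowP => i; rewrite derive_mx// mxE.
exact: derive_val.
Qed.

Lemma is_derive1_reflect n (f : R -> 'rV[R]_n) (t : R) (D : 'rV[R]_n) :
  is_derive (- t) 1 f D -> is_derive t 1 (fun s => f (- s)) (- D).
Proof.
rewrite !is_derive_rowP => fD i.
apply: (@is_derive_eq _ _ _ _ _ _ _ (D 0 i * -1)).
  exact: (is_derive1_comp (fD i) (is_deriveNid _ _)).
by rewrite mxE mulrN1.
Qed.

(** A curve with constant velocity is affine, so it stays bounded only if it does not move. The two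
    parity arguments conclude through this fact. *)
Lemma bounded_is_derive_cst_eq0 n (f : R -> 'rV[R]_n) (c : 'rV[R]_n) (M : R) :
  (forall t : R, is_derive t 1 f c) -> (forall t, `|f t| <= M) -> c = 0.
Proof.
move=> fc fM; apply/rowP => i; rewrite mxE.
have fci (t : R) : is_derive t 1 (fun s => f s 0 i) (c 0 i).
  by apply: (is_derive_rowP _ _ _).1.
have fiM t : `|f t 0 i| <= M.
  by rewrite (le_trans _ (fM t))// [leRHS]/Num.Def.normr/= mx_normrE;
     apply: le_trans (le_bigmax _ _ (ord0, i)).
have E t : f t 0 i = f 0 0 i + c 0 i * t.
  have D (s : R) : is_derive s 1 (fun s => f s 0 i - c 0 i * s) 0.
    by apply: is_derive_eq; rewrite [_ *: _]mulr1 subrr.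
  have := is_derive_0_is_cst t 0 D.
  by rewrite mulr0 subr0 => <-; rewrite subrK.
apply/eqP/contraT => c0.
have M0 : 0 <= M by exact: le_trans (fiM 0).
(* At this time the linear term equals [2 * M + 1], and an initial value of size at most [M] cannot
   bring the sum back within [M]. *)
have := fiM ((2 * M + 1) / c 0 i).
rewrite E mulrCA divff// mulr1 addrC.
have := lerB_normD (2 * M + 1) (f 0 0 i).
have : `|2 * M + 1| = 2 * M + 1.
  by rewrite ger0_norm// addr_ge0// mulr_ge0.
have := fiM 0.
lra.
Qed.

(** Stated over any [numFieldType] because it serves both real rows and the complex rows of the
    clock. *)
Lemma cvg_row (K : numFieldType) (T : Type) (F : set_system T) n
    (f : T -> 'rV[K]_n) (l : 'rV[K]_n) : Filter F ->
  (forall i, f x 0 i @[x --> F] --> l 0 i) -> f x @[x --> F] --> l.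
Proof.
move=> FF fl; apply/cvg_mx_entourageP => A entA.
apply: filter_forall => i; apply: filter_forall => j; rewrite ord1.
have H : \forall x \near F, xsection A (l 0 j) (f x 0 j).
  exact: fl (nbhs_entourage _ entA).
suff : \forall x \near F, (l 0 j, f x 0 j) \in A by [].
by apply: filterS H => x /xsectionP; rewrite inE.
Qed.

End Derivatives.

(** * The torus, the clock flow and complex conjugation *)

Section Clock.
Context {R : realType}.

Lemma continuous_Re : continuous (@complex.Re R : Cx R -> R).
Proof.
move=> z; have Fz := nbhs_filter (z : Cx R).
apply/(cvgrPdist_lt (FF := fmap_filter _ Fz)) => e e0.
(* The norm of [Cx R] takes its values in [Cx R], so the real radius [e] has to be embedded
   there. *)
have e0C : 0 < (e%:C%C : Cx R) by rewrite ltcR.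
near=> y.
have zy : `|z - y| < (e%:C%C : Cx R) by near: y; exact: cvgr_dist_lt.
have := le_lt_trans (normc_ge_Re (z - y : R[i])) zy.
by rewrite ltcR; case: (z) (y) => a b [].
Unshelve. all: by end_near. Qed.

Lemma normc_le_ReIm (a b : R) : `|(a +i* b)%C : Cx R| <= ((`|a| + `|b|)%:C)%C.
Proof.
rewrite normc_def lecR /= -(ler_pXn2r (n := 2)) ?nnegrE ?addr_ge0 ?sqrtr_ge0//.
rewrite sqr_sqrtr ?addr_ge0 ?sqr_ge0// -(real_normK (num_real a)).
rewrite -(real_normK (num_real b)) sqrrD.
by rewrite addrAC lerDl mulrn_wge0// mulr_ge0.
Qed.

Lemma cvg_complex (T : Type) (F : set_system T) (f g : T -> R) (a b : R) :
  Filter F -> f x @[x --> F] --> a -> g x @[x --> F] --> b ->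
  ((f x +i* g x)%C : Cx R) @[x --> F] --> ((a +i* b)%C : Cx R).
Proof.
move=> FF fa gb; apply/cvgrPdist_lt => e.
(* A positive element of [Cx R] has zero imaginary part, so the radius is a positive real. *)
case: e => e e' /[!ltcE]/= /andP[/eqP -> e0].
have e20 : 0 < e / 2 by rewrite divr_gt0.
near=> x.
apply: (le_lt_trans (normc_le_ReIm (a - f x) (b - g x))).
rewrite ltcR (splitr e) ltrD//; near: x.
- by move/cvgrPdist_lt : fa; exact.
- by move/cvgrPdist_lt : gb; exact.
Unshelve. all: by end_near. Qed.

(** The complex circle is the continuous image of the real unit circle, which is closed in the
    compact square [[-1, 1] x [-1, 1]]. *)
Lemma compact_circle : compact [set z : Cx R | `|z| = 1].
Proof.
pose mkC (p : R * R) : Cx R := (p.1 +i* p.2)%C.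
pose A := [set p : R * R | p.1 * p.1 + p.2 * p.2 = 1].
have normE a b : (`|mkC (a, b)| = 1) <-> (a * a + b * b = 1).
  rewrite -!expr2 /mkC normc_def /=.
  split=> [[]/(congr1 (fun x => x ^+ 2))|->].
    by rewrite sqr_sqrtr ?addr_ge0 ?sqr_ge0// expr1n.
  by rewrite sqrtr1.
have -> : [set z : Cx R | `|z| = 1] = mkC @` A.
  apply/seteqP; split => [[a b]/normE ab|_ [[a b] ab <-]]; last exact/normE.
  by exists (a, b).
apply: continuous_compact.
  by apply: continuous_subspaceT => -[a b]; apply: cvg_complex;
    [exact: cvg_fst|exact: cvg_snd].
apply: (@subclosed_compact _ A (`[-1, 1] `*` `[-1, 1])).
- have -> : A = (fun p : R * R => p.1 * p.1 + p.2 * p.2) @^-1` [set 1] by [].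
  apply: preimage_closed => [p _|]; last exact: closed_eq.
  have c1 : q.1 @[q --> p] --> p.1 by exact: cvg_fst.
  have c2 : q.2 @[q --> p] --> p.2 by exact: cvg_snd.
  exact: cvgD (cvgM c1 c1) (cvgM c2 c2).
- by apply: compact_setX; exact: segment_compact.
- by move=> [a b]; rewrite /A/= => ab; rewrite !in_itv/=; split; nra.
Qed.

Lemma compact_torus K : compact (@torus R K).
Proof. exact: (rV_compact (fun=> compact_circle)). Qed.

Lemma expj0 : expj 0 = 1 :> Cx R.
Proof. by rewrite /expj cos0 sin0. Qed.

Lemma expjD (a b : R) : expj (a + b) = expj a * expj b.
Proof. by rewrite /expj cosD sinD; congr (_ +i* _)%C; rewrite addrC. Qed.

Lemma normr_expj (a : R) : `|expj a| = 1.
Proof. by rewrite normc_def/= cos2Dsin2 sqrtr1. Qed.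

Lemma expjN (a : R) : expj (- a) = (expj a)^*.
Proof. by rewrite /expj cosN sinN. Qed.

Lemma continuous_expj : continuous (@expj R).
Proof.
by move=> a; exact: cvg_complex (@continuous_cos R a) (@continuous_sin R a).
Qed.

Context {K : nat} (w : 'I_K -> R).

(** Time reversal of the clock: conjugation carries each orbit onto an orbit run backwards, and the
    signal [Gz G0] does not see it. *)
Definition conjv (z : CK R K) : CK R K := \row_i (z 0 i)^*.

Lemma clock_flow0 z : clock_flow w 0 z = z.
Proof. by apply/rowP => i; rewrite mxE !mulr0 expj0 mul1r. Qed.

Lemma clock_flowD (s t : R) z :
  clock_flow w (s + t) z = clock_flow w s (clock_flow w t z).
Proof. by apply/rowP => i; rewrite !mxE !mulrDr expjD; exact/esym/mulrA. Qed.

Lemma clock_flow_torus t z : torus z -> torus (clock_flow w t z).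
Proof. by move=> zT i; rewrite mxE normrM normr_expj mul1r zT. Qed.

Lemma conjv_torus z : torus z -> torus (conjv z).
Proof. by move=> zT i; rewrite mxE norm_conjC zT. Qed.

Lemma conjv_clock_flow t z :
  conjv (clock_flow w t z) = clock_flow w (- t) (conjv z).
Proof.
by apply/rowP => i; rewrite !mxE rmorphM/= !mulrN expjN.
Qed.

Lemma continuous_clock_flow z : continuous (fun t => clock_flow w t z).
Proof.
move=> t; apply: cvg_row => i; rewrite mxE; under eq_fun do rewrite mxE.
apply: cvgM; last exact: cvg_cst.
apply: (@continuous_comp _ _ _ (fun t => 2 * pi * (w i * t))
  (@expj R)); last exact: continuous_expj.
by apply: cvgM; [exact: cvg_cst|apply: cvgM; [exact: cvg_cst|exact: cvg_id]].
Qed.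

Lemma clock_torus phi t : torus (clock w phi t).
Proof. by move=> i; rewrite mxE normr_expj. Qed.

Lemma clock_clock_flow phi t :
  clock w phi t = clock_flow w t (clock w phi 0).
Proof.
by apply/rowP => i; rewrite !mxE -expjD mulr0 add0r -mulrDr.
Qed.

Context {m : nat} (G0 : 'rV[R]_K -> 'rV[R]_m).

Lemma Gz_conjv z : Gz G0 (conjv z) = Gz G0 z.
Proof.
by congr G0; apply/rowP => i; rewrite !mxE; case: (z 0 i).
Qed.

Lemma Gz_clock phi t : Gz G0 (clock w phi t) = G0 (xi0 w phi t).
Proof. by congr G0; apply/rowP => i; rewrite !mxE. Qed.

Lemma continuous_Gz : continuous G0 -> continuous (Gz G0).
Proof.
move=> G0c z; apply: (@continuous_comp _ _ _
  (fun z : CK R K => \row_i complex.Re (z 0 i)) G0); last exact: G0c.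
apply: (cvg_row (nbhs_filter z)) => i; rewrite mxE; under eq_fun do rewrite mxE.
apply: (@continuous_comp _ _ _ (fun z : CK R K => z 0 i)
  (@complex.Re R : Cx R -> R)).
  exact: coord_continuous.
exact: continuous_Re.
Qed.

End Clock.

(** Continuity on the torus is only continuity within a subset; it can be used along any family of
    points that never leaves this subset. *)
Lemma within_continuous_cvg (T : Type) (U V : topologicalType)
    (F : set_system T) (A : set U) (f : U -> V) (p : T -> U) (p0 : U) :
  Filter F -> {within A, continuous f} -> A p0 -> (forall s, A (p s)) ->
  p s @[s --> F] --> p0 -> f (p s) @[s --> F] --> f p0.
Proof.
move=> FF /subspace_continuousP fA Ap0 Ap pp0 B /(fA _ Ap0) AB.
have {}AB : \forall s \near F, A (p s) -> B (f (p s)) by exact: pp0 AB.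
suff : \forall s \near F, B (f (p s)) by [].
by apply: filterS AB => s; apply.
Qed.

(** * Poisson's equation along the orbits of the clock *)

Section Poisson.
Context {R : realType} {d K : nat}.
Variables (P : probability (borelCK R K) R) (w : 'I_K -> R).
Variables (u uhat : state R d -> CK R K -> 'rV[R]_d).
Hypothesis u_uhat : poisson_solution P w u uhat.
Variable x : state R d.
Hypothesis u_cont : forall z, torus z ->
  continuous (fun t => u x (clock_flow w t z)).

Let integrable_orbit z i T : torus z ->
  (@lebesgue_measure R).-integrable `[0, T]
    (EFin \o (fun t => u x (clock_flow w t z) 0 i)).
Proof.
move=> zT; apply: continuous_compact_integrable; first exact: segment_compact.
apply: continuous_subspaceT => t.
apply: (@continuous_comp _ _ _ (fun t => u x (clock_flow w t z))
  (fun v : 'rV[R]_d => v 0 i)); first exact: u_cont.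
exact: coord_continuous.
Qed.

Let integrable_orbitB z i T : torus z ->
  (@lebesgue_measure R).-integrable `[0, T]
    (EFin \o (fun t => (u x (clock_flow w t z) - mean P u x) 0 i)).
Proof.
move=> zT; apply: continuous_compact_integrable; first exact: segment_compact.
apply: continuous_subspaceT => t.
apply: (@continuous_comp _ _ _ (fun t => u x (clock_flow w t z) - mean P u x)
  (fun v : 'rV[R]_d => v 0 i)); last exact: coord_continuous.
by apply: cvgB; [exact: u_cont|exact: cvg_cst].
Qed.

(** Along an orbit [uhat] is a constant minus an integral with continuous integrand, so the
    fundamental theorem of calculus applies. All real times are covered, as time reversal
    requires. *)
Lemma poisson_is_derive z (t : R) : torus z ->
  is_derive t 1 (fun s => uhat x (clock_flow w s z))
    (- (u x (clock_flow w t z) - mean P u x)).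
Proof.
move=> zT.
wlog t0 : z t zT / 0 < t => [H|].
  (* The equation only covers T >= 0: restart the clock early enough. *)
  pose a := 1 + `|t|.
  have ta : 0 < t + a.
    by rewrite /a addrA; have := ler_norm (- t); rewrite normrN; lra.
  have zE s : clock_flow w s z = clock_flow w (s + a) (clock_flow w (- a) z).
    by rewrite -clock_flowD addrK.
  under eq_fun do rewrite zE.
  rewrite (zE t).
  apply: (@is_derive1_shift _ _
    (fun s => uhat x (clock_flow w s (clock_flow w (- a) z)))).
  by apply: H => //; exact: clock_flow_torus.
apply/is_derive_rowP => i; rewrite mxE.
pose F s := \int[lebesgue_measure]_(r in `[0, s])
   (u x (clock_flow w r z) - mean P u x) 0 i.
(* The integral is taken over [[0, t + 1]], so that [t] is an interior point. *)
have t1 : t < t + 1 by rewrite ltrDl.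
have [Fd FE] : derivable F t 1 /\
    derive1 F t = (u x (clock_flow w t z) - mean P u x) 0 i.
  apply: (continuous_FTC1_closed t1 (integrable_orbitB _ _ zT) t0).
  apply: (@continuous_comp _ _ _ (fun t => u x (clock_flow w t z) - mean P u x)
    (fun v : 'rV[R]_d => v 0 i)); last exact: coord_continuous.
  by apply: cvgB; [exact: u_cont|exact: cvg_cst].
have Fi : is_derive t 1 F ((u x (clock_flow w t z) - mean P u x) 0 i).
  by apply: DeriveDef; [exact: Fd|rewrite -derive1E; exact: FE].
apply: (@near_eq_is_derive _ _ _ (fun s => uhat x z 0 i - F s)).
  near=> s.
  have s0 : 0 <= s by apply: ltW; near: s; exact: lt_nbhsr.
  have [/(_ _ _ zT s0) /rowP/(_ i)] := u_uhat x.
  by rewrite !mxE => + _; rewrite /F => ->; rewrite opprB addrC subrK.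
rewrite -[- _]sub0r.
exact: (is_deriveB (is_derive_cst (uhat x z 0 i) t (1 : R)) Fi).
Unshelve. all: by end_near. Qed.

(** By Poisson's equation the average over [[0, T]] differs from the mean by an increment of [uhat]
    divided by [T]. This increment is at most [2 * M], so the difference tends to 0 without an
    ergodic theorem. *)
Lemma time_average_mean z (M : R) : torus z ->
  (forall z', torus z' -> `|uhat x z'| <= M) ->
  lim (T^-1 *: time_integral (fun t => u x (clock_flow w t z)) T @[T --> +oo])
  = mean P u x.
Proof.
move=> zT uM; apply/cvg_lim => //.
have E (T : R) : 0 < T ->
    T^-1 *: time_integral (fun t => u x (clock_flow w t z)) T =
    mean P u x + T^-1 *: (uhat x z - uhat x (clock_flow w T z)).
  move=> T0; have [/(_ _ _ zT (ltW T0)) <- _] := u_uhat x.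
  suff -> : time_integral (fun t => u x (clock_flow w t z) - mean P u x) T =
      time_integral (fun t => u x (clock_flow w t z)) T - T *: mean P u x.
    by rewrite scalerBr scalerA mulVf ?gt_eqF// scale1r addrC subrK.
  move: (mean P u x) => c; apply/rowP => i; rewrite !mxE.
  have -> : T * c 0 i = \int[lebesgue_measure]_(t in `[0, T]) c 0 i.
    rewrite Rintegral_cst//= lebesgue_measure_itv/= lte_fin T0 -EFinD subr0.
    by rewrite mulrC.
  rewrite -RintegralB//; last 2 first.
  - exact: integrable_orbit.
  - apply: continuous_compact_integrable; first exact: segment_compact.
    by apply: continuous_subspaceT => t; exact: cvg_cst.
  by apply: eq_Rintegral => t _; rewrite !mxE.
suff : (mean P u x + T^-1 *: (uhat x z - uhat x (clock_flow w T z)))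
    @[T --> +oo] --> mean P u x + 0.
  rewrite addr0; apply: cvg_trans; apply: near_eq_cvg; near=> T.
  by rewrite E.
apply: cvgD; first exact: cvg_cst.
apply/cvgr0Pnorm_lt => e e0.
have M0 : 0 <= M by exact: le_trans (uM _ zT).
near=> T.
have T0 : 0 < T by [].
rewrite normrZ gtr0_norm ?invr_gt0// mulrC ltr_pdivrMr//.
have := ler_normB (uhat x z) (uhat x (clock_flow w T z)).
have := uM _ zT; have := uM _ (clock_flow_torus w T zT).
have : (2 * M) / e < T by near: T; apply: nbhs_pinfty_gt; exact: num_real.
rewrite ltr_pdivrMr//.
lra.
Unshelve. all: by end_near. Qed.

End Poisson.

(** * The chain rule along a trajectory *)

Section ChainRule.
Context {R : realType} {d K : nat}.
Implicit Types (u : state R d -> CK R K -> 'rV[R]_d) (x : state R d).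

Lemma is_derive1_pair (V W : normedModType R) (f : R -> V) (g : R -> W)
    (t : R) (Df : V) (Dg : W) :
  is_derive t 1 f Df -> is_derive t 1 g Dg ->
  is_derive t 1 (fun s => (f s, g s)) (Df, Dg).
Proof. by rewrite !is_derive1_cvgP => fD gD; exact: cvg_pair. Qed.

Lemma is_derive_along_line (V W : normedModType R) (f : V -> W) (x v : V)
    (t : R) : differentiable f (x + t *: v) ->
  is_derive t 1 (fun s => f (x + s *: v)) ('d f (x + t *: v) v).
Proof.
move=> fd; rewrite is_derive1_cvgP -deriveE//.
have := diff_derivable (v := v) fd; rewrite /derivable => /cvg_ex[l fl].
rewrite /derive (cvg_lim _ fl)//; apply: cvg_trans fl.
apply: near_eq_cvg; near=> h; rewrite /=.
by rewrite scalerDl addrCA.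
Unshelve. all: by end_near. Qed.

Lemma linear_state (W : lmodType R) (L : {linear state R d -> W})
    (v : state R d) :
  L v = \sum_k v.1 0 k *: L (delta_mx 0 k, 0) +
        \sum_k v.2 0 k *: L (0, delta_mx 0 k).
Proof.
have {1}-> : v = \sum_k v.1 0 k *: ((delta_mx 0 k, 0) : state R d) +
    \sum_k v.2 0 k *: ((0, delta_mx 0 k) : state R d).
  rewrite [LHS]surjective_pairing; congr (_, _) => /=.
    rewrite !raddf_sum /= [X in _ + X]big1 ?addr0; last first.
      by move=> k _; rewrite scaler0.
    exact: row_sum_delta.
  rewrite !raddf_sum /= [X in X + _]big1 ?add0r; last first.
    by move=> k _; rewrite scaler0.
  exact: row_sum_delta.
rewrite linearD !linear_sum.
by congr (_ + _); apply: eq_bigr => k _; rewrite linearZ.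
Qed.

(** In finite dimension, expansion in the basis turns pointwise convergence of linear maps into
    convergence at moving vectors. Hence the continuity of each directional derivative in
    [C1_in_state] gives joint continuity in point, clock and direction. *)
Lemma cvg_linear_state (W : normedModType R) (T : Type) (F : set_system T)
    (L : T -> {linear state R d -> W}) (L0 : {linear state R d -> W})
    (v : T -> state R d) (v0 : state R d) : Filter F ->
  (forall e, L s e @[s --> F] --> L0 e) -> v s @[s --> F] --> v0 ->
  L s (v s) @[s --> F] --> L0 v0.
Proof.
move=> FF dc vv0; rewrite linear_state.
rewrite (funext (fun s => linear_state (L s) (v s))).
have v1 k : (v s).1 0 k @[s --> F] --> v0.1 0 k.
  apply: (cvg_comp (fun s => (v s).1) (fun r : 'rV[R]_d => r 0 k));
    last exact: coord_continuous.
  by apply: cvg_comp vv0 _; exact: cvg_fst.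
have v2 k : (v s).2 0 k @[s --> F] --> v0.2 0 k.
  apply: (cvg_comp (fun s => (v s).2) (fun r : 'rV[R]_d => r 0 k));
    last exact: coord_continuous.
  by apply: cvg_comp vv0 _; exact: cvg_snd.
by apply: cvgD; (apply: cvg_big => [|k _]; [exact: add_continuous|exact: cvgZ]).
Qed.

Lemma MVT01 (f df : R -> R) : (forall s : R, is_derive s 1 f (df s)) ->
  exists2 c, c \in `[0, 1] & f 1 - f 0 = df c.
Proof.
move=> fd.
have fc : {within `[0, 1], continuous f}.
  by apply: derivable_within_continuous => s _; apply: ex_derive.
have [c c01 E] := MVT_segment ler01 (fun s _ => fd s) fc.
by exists c => //; rewrite E subr0 mulr1.
Qed.

Section C1.
Variable u : state R d -> CK R K -> 'rV[R]_d.
Hypothesis uC1 : C1_in_state u.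

Lemma C1_cvg (T : Type) (F : set_system T) (y : T -> state R d)
    (z : T -> CK R K) x z0 : Filter F ->
  (forall s, torus (z s)) -> torus z0 ->
  y s @[s --> F] --> x -> z s @[s --> F] --> z0 ->
  u (y s) (z s) @[s --> F] --> u x z0.
Proof.
move=> FF zT z0T yx zz0; have [uc _ _] := uC1.
have := within_continuous_cvg (p := fun s => (y s, z s)) (p0 := (x, z0)) FF uc.
by apply; [split|move=> s; split => /=|exact: (cvg_pair yx zz0)].
Qed.

Lemma C1_continuous_flow (w : 'I_K -> R) x z : torus z ->
  continuous (fun t => u x (clock_flow w t z)).
Proof.
move=> zT t; have zTs s := clock_flow_torus w s zT.
exact: (C1_cvg (y := fun=> x) (z := fun s => clock_flow w s z)
  (nbhs_filter t) zTs (zTs t) (cvg_cst x) (@continuous_clock_flow _ _ w z t)).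
Qed.

Lemma C1_bounded x : exists M, forall z, torus z -> `|u x z| <= M.
Proof.
have uc : {within @torus R K, continuous (u x)}.
  apply/subspace_continuousP => z zT.
  have [/subspace_continuousP uc _ _] := uC1.
  have xz : ([set: state R d] `*` @torus R K) (x, z) by split.
  move=> B uB.
  have [[B1 B2] /= [xB zB] BB] : nbhs (x, z)
      [set p | ([set: state R d] `*` @torus R K) p -> B (u p.1 p.2)].
    exact: uc xz _ uB.
  suff : \forall z' \near z, torus z' -> B (u x z') by [].
  apply: filterS zB => z' z'B z'T.
  by apply: (BB (x, z')); split => //=; exact: nbhs_singleton.
have [M [_ uM]] := compact_bounded (continuous_compact uc (@compact_torus R K)).
(* The bound is provided by every constant strictly above [M], hence [M + 1]. *)
exists (M + 1) => z zT.
by apply: uM; [rewrite ltrDl|exists z].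
Qed.

Lemma C1_diff_cvg (T : Type) (F : set_system T) (y v : T -> state R d)
    (z : T -> CK R K) x z0 v0 : Filter F ->
  (forall s, torus (z s)) -> torus z0 ->
  y s @[s --> F] --> x -> z s @[s --> F] --> z0 -> v s @[s --> F] --> v0 ->
  'd (u^~ (z s)) (y s) (v s) @[s --> F] --> 'd (u^~ z0) x v0.
Proof.
move=> FF zT z0T yx zz0 vv0; have [_ _ uc] := uC1.
have dc e : 'd (u^~ (z s)) (y s) e @[s --> F] --> 'd (u^~ z0) x e.
  have := within_continuous_cvg (p := fun s => (y s, z s)) (p0 := (x, z0)) FF
    (uc e).
  by apply; [split|move=> s; split => /=|exact: (cvg_pair yx zz0)].
exact: (cvg_linear_state (L := fun s => 'd (u^~ (z s)) (y s))
  (L0 := 'd (u^~ z0) x) FF dc vv0).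
Qed.

(** The mean value theorem is scalar: the intermediate point depends on the coordinate [i]. *)
Lemma C1_mean_value (x v : state R d) z i : torus z ->
  exists2 c, c \in `[0, 1] &
    u (x + v) z 0 i - u x z 0 i = 'd (u^~ z) (x + c *: v) v 0 i.
Proof.
move=> zT; have [_ ud _] := uC1.
have D (s : R) : is_derive s 1 (fun s => u (x + s *: v) z 0 i)
    ('d (u^~ z) (x + s *: v) v 0 i).
  by move: i; apply/is_derive_rowP; apply: is_derive_along_line; exact: ud.
have [c c01 E] := MVT01 D; exists c => //.
by rewrite -E scale1r scale0r addr0.
Qed.

(* As [u] need not be differentiable in [z], the increment in the state at the
   moving clock value is handled by the mean value theorem, coordinatewise. *)
Lemma C1_is_derive (X : R -> state R d) (Phi : R -> CK R K) (t : R)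
    (X' : state R d) (D : 'rV[R]_d) :
  (forall s, torus (Phi s)) -> {for t, continuous Phi} ->
  is_derive t 1 X X' -> is_derive t 1 (fun s => u (X t) (Phi s)) D ->
  is_derive t 1 (fun s => u (X s) (Phi s)) ('d (u^~ (Phi t)) (X t) X' + D).
Proof.
move=> PhiT Phic Xd uD.
have shift_cvg : h + t @[h --> 0^'] --> t.
  have : h + t @[h --> 0^'] --> 0 + t.
    by apply: cvgD; [exact: nbhs_dnbhs|exact: cvg_cst].
  by rewrite add0r.
have Xc : X (h + t) @[h --> 0^'] --> X t.
  have /differentiable_continuous : differentiable X t.
    by apply/derivable1_diffP; apply: ex_derive.
  exact: cvg_comp shift_cvg.
have Phic' : Phi (h + t) @[h --> 0^'] --> Phi t.
  exact: cvg_comp shift_cvg Phic.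
move/is_derive1_cvgP : uD => uD; move/is_derive1_cvgP : Xd => Xd.
apply/is_derive1_cvgP.
(* The increment is split in two: the state moves at the new clock value, then the clock moves with
   the state frozen at [X t]. The second quotient tends to [D] by hypothesis. *)
have E h : h^-1 *: (u (X (h + t)) (Phi (h + t)) - u (X t) (Phi t)) =
    h^-1 *: (u (X (h + t)) (Phi (h + t)) - u (X t) (Phi (h + t))) +
    h^-1 *: (u (X t) (Phi (h + t)) - u (X t) (Phi t)).
  by rewrite -scalerDr addrA subrK.
under eq_fun do rewrite E.
apply: cvgD; last exact: uD.
apply: cvg_row => i.
pose V h : state R d := X (h + t) - X t.
have VE h : X t + V h = X (h + t) by rewrite /V addrC subrK.
have /choice[c cP] h : exists c, c \in `[0, 1] /\
    u (X (h + t)) (Phi (h + t)) 0 i - u (X t) (Phi (h + t)) 0 i =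
    'd (u^~ (Phi (h + t))) (X t + c *: V h) (V h) 0 i.
  have [c c01] := C1_mean_value (X t) (V h) i (PhiT (h + t)).
  by rewrite VE => ?; exists c.
(* By linearity the factor [h^-1] enters the direction, which then converges to [X']. *)
have {}E h :
    (h^-1 *: (u (X (h + t)) (Phi (h + t)) - u (X t) (Phi (h + t)))) 0 i =
    'd (u^~ (Phi (h + t))) (X t + c h *: V h) (h^-1 *: V h) 0 i.
  by rewrite linearZ !mxE (cP h).2.
under eq_fun do rewrite E.
apply: (cvg_comp
  (fun h => 'd (u^~ (Phi (h + t))) (X t + c h *: V h) (h^-1 *: V h))
  (fun r : 'rV[R]_d => r 0 i)); last exact: coord_continuous.
apply: C1_diff_cvg => //.
(* The intermediate point tends to [X t], as [c h] lies in [[0, 1]] and [V h] tends to 0. *)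
rewrite -[X in _ --> X]addr0; apply: cvgD; first exact: cvg_cst.
have V0 : V h @[h --> 0^'] --> (0 : state R d).
  by rewrite -(subrr (X t)); apply: cvgB => //; exact: cvg_cst.
apply/cvgr0Pnorm_lt => e e0; near=> h.
have : `|V h| < e by near: h; exact: cvgr0_norm_lt.
apply: le_lt_trans; rewrite normrZ ler_piMl//.
by have [/[!in_itv]/= /andP[c0 c1] _] := cP h; rewrite ger0_norm.
Unshelve. all: by end_near. Qed.

End C1.

Section partial.
Context {m : nat} (G : CK R K -> 'rV[R]_m).
Implicit Types v : state R d -> 'rV[R]_m -> 'rV[R]_d.

(** Chain rule with the embedding of the first component, whose differential is [a] mapped to
    [(a, 0)]. The companion lemma embeds the second component. *)
Lemma D_thetaE v u x z : differentiable (u^~ z) x ->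
  D_theta G v u x z = 'd (u^~ z) x (v x (G z), 0).
Proof.
case: x => x1 x2 ud; rewrite /D_theta/=.
have Hd : is_diff x1 (fun theta : 'rV[R]_d => (theta, x2)) (fun a => (a, 0)).
  exact: is_diff_pair.
have E := diff_comp (ex_diff (is_diff_def := Hd)) ud.
rewrite (diff_val (is_diff_def := Hd)) in E.
by have := congr1 (fun L => L (v (x1, x2) (G z))) E.
Qed.

Lemma D_lambdaE v u x z : differentiable (u^~ z) x ->
  D_lambda G v u x z = 'd (u^~ z) x (0, v x (G z)).
Proof.
case: x => x1 x2 ud; rewrite /D_lambda/=.
have Hd : is_diff x2 (fun lambda : 'rV[R]_d => (x1, lambda)) (fun a => (0, a)).
  exact: is_diff_pair.
have E := diff_comp (ex_diff (is_diff_def := Hd)) ud.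
rewrite (diff_val (is_diff_def := Hd)) in E.
by have := congr1 (fun L => L (v (x1, x2) (G z))) E.
Qed.

Lemma diff_state_split g h u x z (a b : R) : differentiable (u^~ z) x ->
  'd (u^~ z) x (a *: g x (G z), b *: h x (G z)) =
  a *: D_theta G g u x z + b *: D_lambda G h u x z.
Proof.
move=> ud; rewrite D_thetaE// D_lambdaE// -!linearZ -linearD.
by congr ('d _ _ (_, _)) => /=; rewrite scaler0 ?addr0 ?add0r.
Qed.

End partial.
End ChainRule.

(** * Parity of Poisson solutions under time reversal *)

Section Parity.
Context {R : realType} {d K : nat}.
Variables (P : probability (borelCK R K) R) (w : 'I_K -> R).
Implicit Types u v : state R d -> CK R K -> 'rV[R]_d.

Lemma is_derive_0_row n (f : R -> 'rV[R]_n) (s t : R) :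
  (forall r : R, is_derive r 1 f 0) -> f s = f t.
Proof.
move=> f0; apply/rowP => i.
apply: (is_derive_0_is_cst (f := fun r => f r 0 i)) => r.
by have := (is_derive_rowP _ _ _).1 (f0 r) i; rewrite mxE.
Qed.

Definition cont_orbits u (x : state R d) := forall z, torus z ->
  continuous (fun t => u x (clock_flow w t z)).

Definition bounded_torus u (x : state R d) :=
  exists M : R, forall z, torus z -> `|u x z| <= M.

Lemma poisson_is_derive_conjv u v x z (t : R) : poisson_solution P w u v ->
  cont_orbits u x -> torus z ->
  is_derive t 1 (fun s => v x (clock_flow w (- s) (conjv z)))
    (u x (conjv (clock_flow w t z)) - mean P u x).
Proof.
move=> uv uc zT; rewrite conjv_clock_flow -[X in is_derive _ _ _ X]opprK.
apply: (is_derive1_reflect (f := fun s => v x (clock_flow w s (conjv z)))).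
exact: (poisson_is_derive uv uc _ (conjv_torus zT)).
Qed.

Lemma poisson_odd u v vv x z : poisson_solution P w u v ->
  poisson_solution P w v vv -> cont_orbits u x -> cont_orbits v x ->
  bounded_torus vv x ->
  (forall z', torus z' -> u x (conjv z') = u x z') ->
  torus z -> v x (conjv z) = - v x z.
Proof.
move=> uv vvv uc vc [M vvM] u_even zT.
have v0 := (uv x).2.
pose V t := v x (clock_flow w (- t) (conjv z)) + v x (clock_flow w t z).
(* The derivatives of the two terms of [V] cancel because [u] is even. *)
have VE (t : R) : V t = V 0.
  apply: is_derive_0_row => s.
  have H1 := poisson_is_derive_conjv s uv uc zT.
  have H2 := poisson_is_derive uv uc s zT.
  rewrite u_even in H1; last exact: clock_flow_torus.
  by have := is_deriveD H1 H2; rewrite subrr.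
(* This bounded difference of [vv] has derivative [V t]: the mean of [v], which would appear twice,
   is 0 by the normalization of Poisson solutions. *)
have : V 0 = 0.
  apply: (bounded_is_derive_cst_eq0 (M := M + M) (f := fun t =>
     vv x (clock_flow w (- t) (conjv z)) - vv x (clock_flow w t z))) => t.
    have H1 := poisson_is_derive_conjv t vvv vc zT.
    have H2 := poisson_is_derive vvv vc t zT.
    have := is_deriveB H1 H2; rewrite v0 !subr0 opprK.
    by rewrite conjv_clock_flow -(VE t).
  rewrite (le_trans (ler_normB _ _))// lerD// vvM//;
    apply: clock_flow_torus => //.
  exact: conjv_torus.
by rewrite /V oppr0 !clock_flow0 => /eqP; rewrite addr_eq0 => /eqP.
Qed.

(** For odd forcing the forcing terms cancel and the two means add up instead. The point [z]
    supplies an orbit. *)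
Lemma odd_mean_eq0 u v x (z : CK R K) : poisson_solution P w u v ->
  cont_orbits u x -> bounded_torus v x ->
  (forall z', torus z' -> u x (conjv z') = - u x z') ->
  torus z -> mean P u x = 0.
Proof.
move=> uv uc [M vM] u_odd zT.
suff /eqP : mean P u x *+ 2 = 0.
  by rewrite -scaler_nat scaler_eq0 pnatr_eq0 => /eqP.
apply: (bounded_is_derive_cst_eq0 (M := M + M) (f := fun t =>
   v x (clock_flow w t z) - v x (clock_flow w (- t) (conjv z)))) => t.
  have H1 := poisson_is_derive_conjv t uv uc zT.
  have H2 := poisson_is_derive uv uc t zT.
  rewrite u_odd in H1; last exact: clock_flow_torus.
  have := is_deriveB H2 H1.
  suff -> : - (u x (clock_flow w t z) - mean P u x) -
      (- u x (clock_flow w t z) - mean P u x) = mean P u x *+ 2 by [].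
  by rewrite !opprB opprK addrACA addNr addr0.
rewrite (le_trans (ler_normB _ _))// lerD// vM//; apply: clock_flow_torus => //.
exact: conjv_torus.
Qed.

End Parity.

Lemma lipschitz_bound_continuous (R : realType) (V W : normedModType R)
    (f : V -> W) (L : R) :
  (forall x y, `|f x - f y| <= L * `|x - y|) -> continuous f.
Proof.
move=> fL x; apply/cvgrPdist_lt => e e0; near=> y.
(* The denominator is positive whatever the sign of [L]. *)
have xy : `|x - y| < e / (`|L| + 1).
  by near: y; apply: cvgr_dist_lt => //; rewrite divr_gt0// ltr_wpDl.
rewrite ltr_pdivlMr ?ltr_wpDl// mulrC in xy.
apply: le_lt_trans (fL x y) (le_lt_trans _ xy).
by rewrite ler_wpM2r// (le_trans (ler_norm L))// lerDl.
Unshelve. all: by end_near. Qed.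

(** * Poisson solutions along the two-timescale ODE *)

Section Assembly.
Context {R : realType}.

Lemma is_derive1_scale n (k : R -> R) (f : R -> 'rV[R]_n) (t k' : R)
    (f' : 'rV[R]_n) : is_derive t 1 k k' -> is_derive t 1 f f' ->
  is_derive t 1 (fun s => k s *: f s) (k t *: f' + k' *: f t).
Proof.
move=> kd /is_derive_rowP fd; apply/is_derive_rowP => i.
have E : (fun s => (k s *: f s) 0 i) = k * (fun s => f s 0 i).
  by apply/funext => s; rewrite mxE.
rewrite E !mxE [X in _ + X]mulrC.
exact: is_deriveM.
Qed.

(** The logarithmic derivative of the gain is [- rate]; this is the source of the [rate] term in
    [W_comp] at index 0. *)
Lemma is_derive_gain (rho t : R) : 0 < t ->
  is_derive t 1 (gain rho) (- (rate rho t * gain rho t)).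
Proof.
move=> t0; have t1 : 0 < 1 + t by rewrite addr_gt0.
have -> : - (rate rho t * gain rho t) = - rho * (1 + t) `^ (- rho - 1) * 1.
  rewrite mulr1 powRD; last by rewrite (gt_eqF t1) implybT.
  by rewrite powR_inv1 ?ltW// /rate /gain mulNr mulrA mulrAC.
apply: (is_derive1_comp (f := fun y => y `^ (- rho)) (g := fun s => 1 + s)).
  exact: is_derive1_powR.
rewrite -[X in is_derive _ _ _ X]add0r.
exact: (is_deriveD (is_derive_cst (1 : R) t (1 : R)) (is_derive_id t (1 : R))).
Qed.

Context {d m K : nat}.
Variables (P : probability (borelCK R K) R) (w phi : 'I_K -> R).
Variables (rho beta : R) (G0 : 'rV[R]_K -> 'rV[R]_m).
Variables (g h : state R d -> 'rV[R]_m -> 'rV[R]_d).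
Variables (Theta Lambda : R -> 'rV[R]_d).
Let X (s : R) : state R d := (Theta s, Lambda s).
Let G := Gz G0.
Let Phi := clock w phi.
Hypothesis Theta_ode : forall t : R, 0 < t -> is_derive t 1 Theta
  (gain rho t *: g (X t) (G0 (xi0 w phi t))).
Hypothesis Lambda_ode : forall t : R, 0 < t -> is_derive t 1 Lambda
  (beta *: h (X t) (G0 (xi0 w phi t))).

(** The ODE yields the two directional derivatives, and Poisson's equation yields the contribution
    of the moving clock. *)
Lemma along_is_derive (u v : state R d -> CK R K -> 'rV[R]_d) (t : R) :
  0 < t -> C1_in_state v -> poisson_solution P w u v ->
  (forall x, cont_orbits w u x) ->
  is_derive t 1 (along X Phi v)
    (gain rho t *: along X Phi (D_theta G g v) t
     + beta *: along X Phi (D_lambda G h v) t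
     - (along X Phi u t - mean P u (X t))).
Proof.
move=> t0 vC1 uv uc.
have PhiT := clock_torus w phi.
have Xd : is_derive t 1 X
    (gain rho t *: g (X t) (G (Phi t)), beta *: h (X t) (G (Phi t))).
  by apply: is_derive1_pair; rewrite /G Gz_clock;
    [exact: Theta_ode|exact: Lambda_ode].
have PhiE : Phi = fun s => clock_flow w s (Phi 0).
  by apply/funext => s; exact: clock_clock_flow.
have Phic : continuous Phi by rewrite PhiE; exact: continuous_clock_flow.
have vd : is_derive t 1 (fun s => v (X t) (Phi s))
    (- (along X Phi u t - mean P u (X t))).
  rewrite /along PhiE.
  exact: (poisson_is_derive uv (uc (X t)) t (PhiT 0)).
have := C1_is_derive vC1 PhiT (Phic t) Xd vd.
by rewrite diff_state_split//; case: vC1 => _ + _; apply.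
Qed.

Variables (hhat : state R d -> CK R K -> 'rV[R]_d).

Lemma cont_orbits_h x : continuous G0 -> continuous (h x) ->
  cont_orbits w (fun x z => h x (G z)) x.
Proof.
move=> G0c hc z zT t.
apply: (@continuous_comp _ _ _ (fun t => G (clock_flow w t z)) (h x));
  last exact: hc.
apply: (@continuous_comp _ _ _ (fun t => clock_flow w t z) G);
  last exact: continuous_Gz.
exact: continuous_clock_flow.
Qed.

Lemma cont_orbits_Upsilon x : C1_in_state hhat ->
  cont_orbits w (fun x z => h x (G z)) x ->
  cont_orbits w (Upsilon_ff G h hhat) x.
Proof.
move=> hC1 hc z zT t.
have zTs s := clock_flow_torus w s zT.
have -> : (fun t => Upsilon_ff G h hhat x (clock_flow w t z)) =
    fun t => - 'd (hhat^~ (clock_flow w t z)) x (0, h x (G (clock_flow w t z))).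
  apply/funext => s; rewrite /Upsilon_ff D_lambdaE//.
  by case: hC1 => _ + _; apply.
apply: cvgN.
have vc : ((0, h x (G (clock_flow w s z))) : state R d) @[s --> t] -->
    ((0, h x (G (clock_flow w t z))) : state R d).
  exact: (cvg_pair (f := fun=> 0) (cvg_cst (0 : 'rV[R]_d)) (hc z zT t)).
exact: (C1_diff_cvg hC1 (y := fun=> x) (nbhs_filter t) zTs (zTs t) (cvg_cst x)
  (@continuous_clock_flow _ _ w z t) vc).
Qed.

(** Oddness of [hhat] holds at every state, so it passes to the derivative in the state; the
    direction [h] is even. *)
Lemma Upsilon_odd x z : C1_in_state hhat ->
  (forall y z', torus z' -> hhat y (conjv z') = - hhat y z') ->
  torus z -> Upsilon_ff G h hhat x (conjv z) = - Upsilon_ff G h hhat x z.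
Proof.
move=> [_ hd _] h_odd zT; rewrite /Upsilon_ff.
rewrite !D_lambdaE; [|exact: hd|exact/hd/conjv_torus].
rewrite /G Gz_conjv -/G.
have -> : hhat^~ (conjv z) = - (hhat^~ z) by apply/funext => y; exact: h_odd.
by have := congr1 (fun L => - L (0, h x (G z))) (diffN (hd x z zT)).
Qed.

End Assembly.

(** The elimination as pure algebra: [b], [a], [r] stand for [beta], gain and rate, [H] for the
    value of [h], [HH] for [hhathat], [U] for [Uffhat], and a prime for a time derivative. The three
    groups are the contributions of the components 0, 1 and 2 of [W_comp]. *)
Lemma noise_decomposition (R : fieldType) (d : nat) (a b r : R)
    (H hb mu DthH DlaH DthHH DthHH' DlaHH' DthU DlaU : 'rV[R]_d) :
  b != 0 ->
  H = hb - b *: mu +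
    (b ^+ 2 *: (- DlaU + (a / b ^+ 2) *: (r *: DthHH - - DthH - b *: DthU))
     + (b *: (- DlaHH' + (a *: DthU + b *: DlaU - (- DlaH - mu))
              - (a / b) *: DthHH')
        + (a *: DthHH' + - (r * a) *: DthHH + b *: DlaHH'
           - (a *: DthH + b *: DlaH - (H - hb))))).
Proof. by move=> b0; apply/rowP => i; rewrite !mxE; field. Qed.

(** * Decomposition of the fast dynamics *)

Theorem theorem2p1 (R : realType) (d m K : nat)
  (hd : (0 < d)%N) (hm : (0 < m)%N) (hK : (0 < K)%N)
  (* probing signal and clock *)
  (G0 : 'rV[R]_K -> 'rV[R]_m) (w phi : 'I_K -> R)
  (G0_cont : continuous G0)
  (G0_analytic : real_analytic G0)
  (p q : 'I_K -> nat)
  (pq_pos : forall i, (0 < p i)%N /\ (0 < q i)%N)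
  (pq_neq : forall i, p i <> q i)
  (w_log : forall i, w i = ln ((p i)%:R / (q i)%:R))
  (w_pos : forall i, 0 < w i)
  (w_inj : injective w)
  (P : probability (borelCK R K) R) (P_unif : uniform_on_torus P)
  (* gains *)
  (rho beta : R) (rho_gt : 1 / 2 < rho) (rho_lt : rho < 1) (beta_gt0 : 0 < beta)
  (* vector field and its averages *)
  (g h : state R d -> 'rV[R]_m -> 'rV[R]_d)
  (Lf : R)
  (f_lip_x : forall (x x' : state R d) (y : 'rV[R]_m),
     `|((g x' y, h x' y) : state R d) - (g x y, h x y)| <= Lf * `|x' - x|)
  (f_lip_xi : forall (x : state R d) (y y' : 'rV[R]_m),
     `|((g x y', h x y') : state R d) - (g x y, h x y)| <= Lf * `|y' - y|)
  (fbar_lip : forall x x' : state R d,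
     `|((time_average g (fun t => G0 (xi0 w phi t)) x',
         time_average h (fun t => G0 (xi0 w phi t)) x') : state R d)
       - (time_average g (fun t => G0 (xi0 w phi t)) x,
          time_average h (fun t => G0 (xi0 w phi t)) x)| <= Lf * `|x' - x|)
  (* solutions of Poisson's equation *)
  (hhat hhathat Uffhat : state R d -> CK R K -> 'rV[R]_d)
  (hhatP : poisson_solution P w (fun x z => h x (Gz G0 z)) hhat)
  (hhathatP : poisson_solution P w hhat hhathat)
  (UffhatP : poisson_solution P w (Upsilon_ff (Gz G0) h hhat) Uffhat)
  (hhat_C1 : C1_in_state hhat)
  (hhathat_C1 : C1_in_state hhathat)
  (Uffhat_C1 : C1_in_state Uffhat)
  (* the two-timescale QSA ODE *)
  (Theta Lambda : R -> 'rV[R]_d)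
  (Theta_ode : forall t : R, 0 < t ->
     is_derive t 1 Theta
       (gain rho t *: g (Theta t, Lambda t) (G0 (xi0 w phi t))))
  (Lambda_ode : forall t : R, 0 < t ->
     is_derive t 1 Lambda
       (beta *: h (Theta t, Lambda t) (G0 (xi0 w phi t))))
  (* the time derivatives in the definition of W are meaningful *)
  (Dg_diff : forall t : R, 0 < t ->
     derivable (along (fun s => (Theta s, Lambda s)) (clock w phi)
                  (D_theta (Gz G0) g hhathat)) t 1)
  (Dh_diff : forall t : R, 0 < t ->
     derivable (along (fun s => (Theta s, Lambda s)) (clock w phi)
                  (D_lambda (Gz G0) h hhathat)) t 1) :
  (forall x : state R d, mean P (Upsilon_ff (Gz G0) h hhat) x = 0) /\
  forall t : R, 0 < t ->
    let X := fun s : R => (Theta s, Lambda s) in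
    let W := W_comp rho beta (Gz G0) g h hhat hhathat Uffhat X (clock w phi) in
    [/\ derivable (W 1%N (gain rho t)) t 1,
        derivable (W 2%N (gain rho t)) t 1,
        derivable (derive1n 1 (W 2%N (gain rho t))) t 1
      & is_derive t 1 Lambda
          (beta *: (time_average h (fun s => G0 (xi0 w phi s)) (X t)
                    - beta *: mean P (Upsilon_ff (Gz G0) h hhat) (X t)
                    + W_noise rho beta (Gz G0) g h hhat hhathat Uffhat X
                        (clock w phi) t))].
Proof.
pose G := Gz G0.
have beta0 : beta != 0 by rewrite gt_eqF.
have h_cont x : continuous (h x).
  apply: (lipschitz_bound_continuous (L := Lf)) => y y'.
  (* The norm of a pair is a maximum, so the Lipschitz bound on [(g, h)] bounds [h] alone. *)
  by have := f_lip_xi x y' y; rewrite prod_normE ge_max => /andP[].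
have h_orb x : cont_orbits w (fun x z => h x (G z)) x.
  exact: (@cont_orbits_h R d m K w G0 h x G0_cont (h_cont x)).
have hhat_orb x : cont_orbits w hhat x.
  by move=> z zT; exact: (C1_continuous_flow hhat_C1 zT).
have Ups_orb x : cont_orbits w (Upsilon_ff G h hhat) x.
  exact: (@cont_orbits_Upsilon R d m K w G0 h hhat x hhat_C1 (h_orb x)).
have PhiT := clock_torus w phi.
have hhat_odd y z : torus z -> hhat y (conjv z) = - hhat y z.
  move=> zT; apply: (poisson_odd hhatP hhathatP) zT => //.
    exact: C1_bounded.
  by move=> z' _; rewrite Gz_conjv.
split=> [x|t t0 X W].
  apply: (odd_mean_eq0 UffhatP (Ups_orb x)) (PhiT 0); first exact: C1_bounded.
  by move=> z' z'T; exact: Upsilon_odd.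
pose al u := along (fun s => (Theta s, Lambda s) : state R d) (clock w phi) u.
pose dth u := al (D_theta G g u); pose dla u := al (D_lambda G h u).
have al_d u v (s : R) : 0 < s -> C1_in_state v -> poisson_solution P w u v ->
    (forall x, cont_orbits w u x) ->
    is_derive s 1 (al v) (gain rho s *: dth v s + beta *: dla v s
      - (al u s - mean P u (Theta s, Lambda s))).
  exact: (@along_is_derive R d m K P w phi rho beta G0 g h Theta Lambda
    Theta_ode Lambda_ode).
have hhat_d := al_d _ _ _ t0 hhat_C1 hhatP h_orb.
have hhathat_d s (s0 : 0 < s) := al_d _ _ _ s0 hhathat_C1 hhathatP hhat_orb.
have Uffhat_d := al_d _ _ _ t0 Uffhat_C1 UffhatP Ups_orb.
(* The average along the actual signal is the mean over the torus, since [hhat] is bounded there. *)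
have hbar : time_average h (fun s => G0 (xi0 w phi s)) (Theta t, Lambda t) =
    mean P (fun x z => h x (G z)) (Theta t, Lambda t).
  have [M hM] := C1_bounded hhat_C1 (Theta t, Lambda t).
  rewrite -(time_average_mean hhatP (h_orb _) (PhiT 0) hM) /time_average.
  congr (lim (_ @ +oo)); apply/funext => T; congr (_ *: time_integral _ _).
  by apply/funext => s; rewrite -clock_clock_flow Gz_clock.
have DgP : is_derive t 1 (dth hhathat) ('D_1 (dth hhathat) t).
  exact: derivableP (Dg_diff t t0).
have DhP : is_derive t 1 (dla hhathat) ('D_1 (dla hhathat) t).
  exact: derivableP (Dh_diff t t0).
(* The gain is frozen at time [t], so its factor is a constant and the product rule does not
   enter. *)
have W1_d : is_derive t 1 (W 1%N (gain rho t)) _ :=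
  is_deriveB (is_deriveD (is_deriveN DhP) Uffhat_d) (is_deriveZ _ DgP).
(* A second differentiation needs the first derivative on a neighbourhood of [t]. Here the gain
   comes from the ODE and varies with [s], so its derivative does enter [W2_d]; the mean of [hhat]
   is 0 by normalization. *)
have W2E : \forall s \near t, gain rho s *: dth hhathat s
     + beta *: dla hhathat s - al hhat s = derive1n 1 (W 2%N (gain rho t)) s.
  near=> s; have s0 : 0 < s by near: s; exact: lt_nbhsr.
  have Hs : is_derive s 1 (W 2%N (gain rho t)) _ := hhathat_d s s0.
  by rewrite /= derive1E (derive_val (is_derive := Hs)) (hhatP _).2 subr0.
have W2_d : is_derive t 1 (derive1n 1 (W 2%N (gain rho t))) _ :=
  near_eq_is_derive W2E (is_deriveB (is_deriveD
  (is_derive1_scale (is_derive_gain rho t0) DgP) (is_deriveZ beta DhP)) hhat_d).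
split.
- by case: W1_d.
- by case: (hhathat_d t t0).
- by case: W2_d.
apply: is_derive_eq (Lambda_ode t t0) _; congr (_ *: _).
have -> : W_noise rho beta G g h hhat hhathat Uffhat X (clock w phi) t =
    beta ^+ 2 *: W 0%N (gain rho t) t + (beta *: 'D_1 (W 1%N (gain rho t)) t
     + 'D_1 (derive1n 1 (W 2%N (gain rho t))) t).
  rewrite /W_noise !big_ord_recl big_ord0 addr0.
  by rewrite /= !derive1E subn0 expr1 expr0 scale1r.
rewrite (derive_val (is_derive := W1_d)) (derive_val (is_derive := W2_d)) hbar.
rewrite -Gz_clock.
exact: (noise_decomposition (gain rho t) (rate rho t)
  (h (Theta t, Lambda t) (G (clock w phi t)))
  (mean P (fun x z => h x (G z)) (Theta t, Lambda t))
  (mean P (Upsilon_ff G h hhat) (Theta t, Lambda t)) (dth hhat t) (dla hhat t)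
  (dth hhathat t) ('D_1 (dth hhathat) t) ('D_1 (dla hhathat) t)
  (dth Uffhat t) (dla Uffhat t) beta0).
Unshelve. all: by end_near. Qed.
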